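(* Let $G$ be a (discrete) group and let $H\subset G$ be a finite set. Suppose there is an element $w\in H$ such that for every positive integer $n$ there are elements $r=r^{(n)},s=s^{(n)}\in G$ and a set $\{c_1,\ldots,c_n\}=\{c_1^{(n)},\ldots,c_n^{(n)}\}\subset G$ with $c_i\in C_G(swr)$ for all $i$, such that $$\lim_{n\to\infty}\frac1n\Big\|\sum_{i=1}^n\lambda(c_i\,s\,g\,r\,c_i^{-1})\Big\|=0\quad\text{for all } g\in H\setminus\{w\}.$$ Then for all complex coefficients $(\beta_g)_{g\in H}$ with $\beta_w\neq 0$, the ideal of $C^*_\lambda(G)$ generated by $\sum_{g\in H}\beta_g\lambda(g)$ is equal to $C^*_\lambda(G)$.
   Context: $C_G(x)$ denotes the centralizer of $x$ in $G$. $\lambda$ is the left regular representation of $G$ on $\ell^2(G)$, $C^*_\lambda(G)$ is the reduced $C^*$-algebra of $G$ (the norm closure of the span of $\lambda(G)$ in $B(\ell^2(G))$), and $\|\cdot\|$ is the operator norm. Ideals are two-sided. *)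

(* Defs.v *)
(* The complex numbers are R[i], for an arbitrary R : realType; a groupType may
   be infinite. *)
From HB Require Import structures.
From mathcomp Require Import all_boot all_order all_algebra finmap.
From mathcomp Require Import complex.
From mathcomp Require Import ring.
From mathcomp Require Import all_classical all_reals all_analysis.
Import Order.TTheory GRing.Theory Num.Theory.
Import Normc.

Set Implicit Arguments.
Unset Strict Implicit.
Unset Printing Implicit Defensive.

Local Open Scope classical_set_scope.
Local Open Scope ring_scope.

Section Ell2.
Variables (R : realType) (G : groupType).

Definition sqnorm (f : G -> R[i]^o) : \bar R :=
  \esum_(x in [set: G]) ((normc (f x)) ^+ 2)%:E.

Definition ell2_pred : {pred (G -> R[i]^o)} := fun f => (sqnorm f < +oo)%E.

Lemma normc_ge0 (z : R[i]) : 0 <= normc z.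
Proof. by case: z => a b; rewrite /normc sqrtr_ge0. Qed.

Lemma ell2_submod_closed : submod_closed ell2_pred.
Proof.
split.
  rewrite /in_mem /= /ell2_pred /sqnorm esum1 ?ltry// => x _.
  by have -> : (0 : G -> R[i]^o) x = 0 by []; rewrite normc0 expr0n.
move=> a f g; rewrite /in_mem /= /ell2_pred => finf fing.
have le2 : (sqnorm (a *: f + g)%R <=
    \esum_(x in [set: G])
      (((2 * normc a ^+ 2)%R%:E * ((normc (f x)) ^+ 2)%:E)
       + (2%:E * ((normc (g x)) ^+ 2)%:E)))%E.
  apply: le_esum => x _.
  rewrite -!EFinM -EFinD lee_fin.
  set u := a * f x.
  have -> : (a *: f + g) x = u + g x by [].
  rewrite -mulrA -exprMn -normcM -/u -mulrDr.
  apply: (@le_trans _ _ ((normc u + normc (g x)) ^+ 2)).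
    by rewrite lerXn2r ?nnegrE ?addr_ge0 ?normc_ge0// le_normcD.
  rewrite -subr_ge0.
  have -> : 2 * (normc u ^+ 2 + normc (g x) ^+ 2) - (normc u + normc (g x)) ^+ 2
     = (normc u - normc (g x)) ^+ 2.
    rewrite mulr_natl mulr2n sqrrD sqrrB; ring.
  exact: sqr_ge0.
have sumZ (k : R) (h : G -> R) : 0 <= k -> (forall x, 0 <= h x) ->
    (\esum_(x in [set: G]) (h x)%:E < +oo ->
     \esum_(x in [set: G]) (k%:E * (h x)%:E) < +oo)%E.
  move=> k0 h0 hfin.
  apply: (@le_lt_trans _ _ (k%:E * \esum_(x in [set: G]) (h x)%:E)%E).
    apply: ge_ereal_sup => _ [X [finX XT] <-].
    rewrite -ge0_mule_fsumr; last by move=> x; rewrite lee_fin.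
    by rewrite lee_pmul ?lee_fin ?fsume_ge0// ?esum_ge// => [x _|];
      [rewrite lee_fin | exists X].
  rewrite lte_mul_pinfty ?lee_fin//.
apply: (le_lt_trans le2); rewrite esumD.
- rewrite lte_add_pinfty// sumZ// => *; rewrite ?mulr_ge0 ?exprn_ge0 ?normc_ge0//.
- by move=> x _; rewrite -EFinM lee_fin !mulr_ge0 ?exprn_ge0 ?normc_ge0.
- by move=> x _; rewrite -EFinM lee_fin !mulr_ge0 ?exprn_ge0 ?normc_ge0.
Qed.

HB.instance Definition _ :=
  GRing.isSubmodClosed.Build R[i] (G -> R[i]^o) ell2_pred ell2_submod_closed.

Record ell2 := Ell2 { ell2_fun :> G -> R[i]^o; ell2P : ell2_fun \in ell2_pred }.

HB.instance Definition _ := [isSub for ell2_fun].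
HB.instance Definition _ := [Choice of ell2 by <:].
HB.instance Definition _ := [SubChoice_isSubLmodule of ell2 by <:].

Definition ell2_norm (f : ell2) : R := Num.sqrt (fine (sqnorm f)).

(* The algebra structure on operators is the one of plain functions: pointwise
   sum and scaling, and composition \o. *)
Definition bounded_operator (T : ell2 -> ell2) : Prop :=
  linear T /\ exists M : R, forall f, ell2_norm (T f) <= M * ell2_norm f.

(* Only meaningful on bounded operators: sup of an unbounded set is 0. *)
Definition opnorm (T : ell2 -> ell2) : R :=
  sup [set ell2_norm (T f) | f in [set f | ell2_norm f <= 1]].

Lemma translate_ell2 (g : G) (f : ell2) :
  (fun x => f (g^-1 * x)%g) \in ell2_pred.
Proof.
have := ell2P f; rewrite /in_mem /= /ell2_pred /sqnorm.
rewrite (reindex_esum [set: G] [set: G] (fun x => (g^-1 * x)%g))//.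
split=> // [x y _ _ /mulgI //|y _].
by exists (g * y)%g => //; rewrite mulKg.
Qed.

Definition lambda (g : G) (f : ell2) : ell2 := Ell2 (translate_ell2 g f).

Definition span_lambda : set (ell2 -> ell2) :=
  [set T | exists (S : {fset G}) (a : G -> R[i]),
     T = \sum_(g <- S) a g *: lambda g].

Definition reduced_Cstar : set (ell2 -> ell2) :=
  [set T | bounded_operator T /\
     forall e : R, 0 < e -> exists2 S, span_lambda S & opnorm (T - S) < e].

(* Two-sided, and not required to be norm closed. *)
Definition ideal_of (A J : set (ell2 -> ell2)) : Prop :=
  [/\ J `<=` A,
      J 0,
      forall S T, J S -> J T -> J (S + T),
      forall (a : R[i]) T, J T -> J (a *: T) &
      forall S T, A S -> J T -> J (S \o T) /\ J (T \o S)].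

Definition ideal_generated (A : set (ell2 -> ell2)) (T : ell2 -> ell2) :
  set (ell2 -> ell2) := smallest (ideal_of A) [set T].

End Ell2.

Arguments lambda R {G} g f.
Arguments reduced_Cstar R G : clear implicits.

Definition centralizer (G : groupType) (x : G) : set G := [set c | commute c x].

(* Main.v *)
Require Import Defs.
From mathcomp Require Import all_boot all_order all_algebra finmap.
From mathcomp Require Import complex ring.
From mathcomp Require Import all_classical all_reals all_analysis.
Import Order.TTheory GRing.Theory Num.Theory.
Import numFieldNormedType.Exports.
Local Open Scope classical_set_scope.
Local Open Scope ring_scope.

(** The ideal generated by X = \sum_(g <- H) beta g *: lambda g contains every
    two-sided combination of X, in particular the normalised average
      Z = (n beta_w)^-1 \sum_i lambda (k c_i s) X lambda (r c_i^-1),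
    with k = (s w r)^-1.  Since c_i commutes with s w r, the term g = w of X
    contributes k c_i (s w r) c_i^-1 = 1 for each i, hence the identity in
    total; the term of any other g contributes
      beta_g / beta_w lambda k (n^-1 \sum_i lambda (c_i s g r c_i^-1)),
    whose norm tends to 0 by hypothesis ([averagedE], [averaged_near_id]).
    For n large enough 1 - Z therefore has norm < 1, and its Neumann series
    converges in the reduced C*-algebra to a left inverse of Z
    ([neumann_inverse]).  The ideal then contains the identity.

    The Neumann series is summed one vector at a time: for a fixed f, the terms
    E^k f have geometrically decreasing norms, so their sum exists by the
    completeness of l^2 for such series ([ell2_geometric_series]).  The sum is
    characterised by its distance to the partial sums, and each property of the
    limit operator (linearity, membership in the algebra, being an inverse) is
    an identity up to an error bounded by a multiple of q^N
    ([geometric_bound_eq0]). *)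

(** * The norm of l^2 and the convergence of geometric series *)

Section Ell2Norm.
Set Implicit Arguments.
Unset Strict Implicit.
Import Normc.
Variables (R : realType) (G : groupType).
Implicit Types (f g : ell2 R G) (M : R) (X : {fset G}).

Lemma sqnorm_ge_fsum (h : G -> R[i]^o) X :
  ((\sum_(x <- X) normc (h x) ^+ 2)%:E <= sqnorm h)%E.
Proof.
apply: esum_ge; exists [set` X]; first by split=> //; exact: finite_fset.
by rewrite -fsbig_seq ?fset_uniq// sumEFin.
Qed.

Lemma sqnorm_le (h : G -> R[i]^o) M :
  (forall X, \sum_(x <- X) normc (h x) ^+ 2 <= M) -> (sqnorm h <= M%:E)%E.
Proof.
move=> hM; apply: ge_ereal_sup => _ [X [finX _] <-].
by rewrite fsbig_finite//= sumEFin lee_fin.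
Qed.

Lemma sqnorm_ge0 (h : G -> R[i]^o) : (0 <= sqnorm h)%E.
Proof. by apply: esum_ge0 => x _; rewrite lee_fin exprn_ge0// normc_ge0. Qed.

Lemma ell2_norm_ge0 f : 0 <= ell2_norm f. Proof. exact: sqrtr_ge0. Qed.

Lemma sqr_ell2_norm f : (ell2_norm f ^+ 2)%:E = sqnorm f.
Proof.
have f0 := sqnorm_ge0 f; have : (sqnorm f < +oo)%E by exact: (ell2P f).
rewrite sqr_sqrtr; last by rewrite fine_ge0.
by move=> foo; rewrite fineK// ge0_fin_numE.
Qed.

(** Reduces estimates of norms to finite sums, where no summability question
    arises. *)
Lemma ell2_norm_leP f M : 0 <= M ->
  reflect (forall X, \sum_(x <- X) normc (f x) ^+ 2 <= M ^+ 2)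
          (ell2_norm f <= M).
Proof.
move=> M0; rewrite -(ler_pXn2r (ltn0Sn 1)) ?nnegrE ?ell2_norm_ge0//.
rewrite -lee_fin sqr_ell2_norm; apply: (iffP idP) => [fM X|]; last exact: sqnorm_le.
by rewrite -lee_fin (le_trans (sqnorm_ge_fsum f X)).
Qed.

Lemma normc_le_ell2_norm f x : normc (f x) <= ell2_norm f.
Proof.
have /ell2_norm_leP -/(_ (ell2_norm_ge0 f) [fset x]%fset) := lexx (ell2_norm f).
by rewrite big_seq_fset1 ler_pXn2r// nnegrE ?normc_ge0 ?ell2_norm_ge0.
Qed.

Lemma ell2_norm0 : ell2_norm (0 : ell2 R G) = 0.
Proof.
apply/le_anti; rewrite ell2_norm_ge0 andbT; apply/ell2_norm_leP => // X.
by rewrite big1 ?expr0n// => x _; rewrite [X in normc X](_ : _ = 0)// normc0 expr0n.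
Qed.

Lemma ell2_norm_eq0 f : ell2_norm f = 0 -> f = 0.
Proof.
move=> f0; apply/val_inj/funext => x /=; apply: eq0_normc.
by apply/le_anti; rewrite normc_ge0 -f0 normc_le_ell2_norm.
Qed.

Lemma ell2_normZ_le (a : R[i]) f : ell2_norm (a *: f) <= normc a * ell2_norm f.
Proof.
have na0 := normc_ge0 a; have nf0 := ell2_norm_ge0 f.
apply/ell2_norm_leP => [|X]; first exact: mulr_ge0.
rewrite exprMn.
under eq_bigr => x _ do rewrite [X in normc X](_ : _ = a * f x)// normcM exprMn.
rewrite -mulr_sumr ler_wpM2l ?exprn_ge0//.
by apply/ell2_norm_leP.
Qed.

(** Minkowski's inequality, from a pointwise one: for a, b > 0 the square
    (u + v)^2 is at most (a + b) (u^2 / a + v^2 / b), the difference being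
    (b u - a v)^2 / (a b).  Summing with a and b slightly above the two norms
    gives (a + b)^2. *)
Lemma ell2_normD f g : ell2_norm (f + g) <= ell2_norm f + ell2_norm g.
Proof.
apply/ler_addgt0Pr => e e0.
(* The margin e / 2 makes a and b invertible even if f or g is zero. *)
pose a := ell2_norm f + e / 2; pose b := ell2_norm g + e / 2.
have e20 : 0 < e / 2 by rewrite divr_gt0.
have a0 : 0 < a by rewrite ltr_wpDl ?ell2_norm_ge0.
have b0 : 0 < b by rewrite ltr_wpDl ?ell2_norm_ge0.
have -> : ell2_norm f + ell2_norm g + e = a + b by rewrite /a /b; field.
apply/ell2_norm_leP => [|X]; first exact: ltW (addr_gt0 a0 b0).
have fa : \sum_(x <- X) normc (f x) ^+ 2 <= a ^+ 2.
  by apply/ell2_norm_leP; rewrite ?lerDl; exact: ltW.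
have gb : \sum_(x <- X) normc (g x) ^+ 2 <= b ^+ 2.
  by apply/ell2_norm_leP; rewrite ?lerDl; exact: ltW.
have pw x : normc ((f + g) x) ^+ 2 <=
    (a + b) / a * normc (f x) ^+ 2 + (a + b) / b * normc (g x) ^+ 2.
  have -> : (f + g) x = f x + g x by [].
  set u := normc (f x); set v := normc (g x).
  apply: (@le_trans _ _ ((u + v) ^+ 2)).
    by rewrite lerXn2r ?nnegrE ?addr_ge0 ?normc_ge0// le_normcD.
  rewrite -subr_ge0 (_ : _ - _ = (b * u - a * v) ^+ 2 / (a * b)).
    by rewrite divr_ge0 ?sqr_ge0 ?mulr_ge0 ?ltW.
  by field; rewrite !gt_eqF.
apply: le_trans (ler_sum _ (fun x _ => pw x)) _.
rewrite big_split/= -!mulr_sumr.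
have -> : (a + b) ^+ 2 = (a + b) / a * a ^+ 2 + (a + b) / b * b ^+ 2.
  by field; rewrite !gt_eqF.
by rewrite lerD// ler_wpM2l// divr_ge0// ltW// addr_gt0.
Qed.

Lemma ell2_norm_lambda (g : G) f : ell2_norm (lambda R g f) = ell2_norm f.
Proof.
rewrite /ell2_norm; congr (Num.sqrt (fine _)); rewrite /sqnorm.
rewrite [RHS](reindex_esum [set: G] [set: G] (fun x => (g^-1 * x)%g))//.
split=> // [x y _ _ /mulgI //|y _].
by exists (g * y)%g => //; rewrite mulKg.
Qed.

(** Fatou's lemma for l^2: a bound on the norm is a bound on every finite partial
    sum of squares, and those pass to a pointwise limit. *)
Lemma ell2_pointwise_limit (F : nat -> ell2 R G) (h : G -> R[i]^o) M :
    0 <= M -> (\forall n \near \oo, ell2_norm (F n) <= M) ->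
    (forall x, normc (F n x) @[n --> \oo] --> normc (h x)) ->
  exists2 v : ell2 R G, v = h :> (G -> R[i]^o) & ell2_norm v <= M.
Proof.
move=> M0 FM Fh.
have hM X : \sum_(x <- X) normc (h x) ^+ 2 <= M ^+ 2.
  have cv : (\sum_(x <- X) normc (F n x) ^+ 2) @[n --> \oo] -->
            \sum_(x <- X) normc (h x) ^+ 2.
    apply: cvg_big => [|x _]; first exact: add_continuous.
    by rewrite expr2; apply: cvgM.
  rewrite -(cvg_lim _ cv)//; apply: limr_le; first by apply/cvg_ex; eexists; exact: cv.
  near=> n; have FnM : ell2_norm (F n) <= M by near: n.
  by apply/ell2_norm_leP.
have h2 : h \in ell2_pred (R:=R) (G:=G).
  by rewrite /in_mem /= /ell2_pred (le_lt_trans (sqnorm_le hM))// ltry.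
by exists (Ell2 h2) => //; apply/ell2_norm_leP.
Unshelve. all: by end_near. Qed.

Lemma normc_cvg (z : nat -> R[i]) (l : R[i]) :
    complex.Re (z n) @[n --> \oo] --> complex.Re l ->
    complex.Im (z n) @[n --> \oo] --> complex.Im l ->
  normc (z n) @[n --> \oo] --> normc l.
Proof.
have normcE w : normc w = Num.sqrt (complex.Re w ^+ 2 + complex.Im w ^+ 2).
  by case: w.
move=> zr zi; rewrite normcE; under eq_fun do rewrite normcE.
have sq : complex.Re (z n) ^+ 2 + complex.Im (z n) ^+ 2 @[n --> \oo] -->
    complex.Re l ^+ 2 + complex.Im l ^+ 2.
  by rewrite !expr2; under eq_fun do rewrite !expr2; apply: cvgD; apply: cvgM.
exact: (cvg_comp _ _ sq (@sqrt_continuous R _)).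
Qed.

Lemma le_Re_normc (z : R[i]) : `|complex.Re z| <= normc z.
Proof. by case: z => a b /=; rewrite -sqrtr_sqr ler_wsqrtr// lerDl sqr_ge0. Qed.

Lemma le_Im_normc (z : R[i]) : `|complex.Im z| <= normc z.
Proof. by case: z => a b /=; rewrite -sqrtr_sqr ler_wsqrtr// lerDr sqr_ge0. Qed.

(** The form of completeness used by the Neumann series.  The sum is built
    coordinate by coordinate from the real and imaginary parts, which converge
    absolutely; the norm bound on the remainder is that of the finite sums
    S (N + m) - S N, transported to the limit by [ell2_pointwise_limit]. *)
Lemma ell2_geometric_series (F : nat -> ell2 R G) (C q : R) :
    0 <= q < 1 -> (forall k, ell2_norm (F k) <= C * q ^+ k) ->
  exists v : ell2 R G, forall N,
    ell2_norm (v - \sum_(k < N) F k) <= C / (1 - q) * q ^+ N.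
Proof.
move=> /andP[q0 q1] FC.
have C0 : 0 <= C by rewrite (le_trans (ell2_norm_ge0 (F 0%N)))// -[C]mulr1.
have q10 : 0 < 1 - q by rewrite subr_gt0.
pose S N := \sum_(k < N) F k.
have coord_cvg (p : R[i] -> R) : (forall z, `|p z| <= normc z) ->
    (forall y z, p (y + z) = p y + p z) -> p 0 = 0 ->
    forall x, cvgn (fun n => p (S n x)).
  move=> pn pD p0 x.
  have -> : (fun n => p (S n x)) = series (fun k => p (F k x)).
    apply/funext => n; rewrite /S /series/= big_mkord.
    by apply: (big_morph (fun f : ell2 R G => p (f x))) => // f g; exact: pD.
  apply: normed_cvg; apply: series_le_cvg (is_cvg_geometric_series (a := C) (z := q) _).
  - by move=> k /=.
  - by move=> k; rewrite /geometric/= mulr_ge0// exprn_ge0.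
  - move=> k /=; rewrite (le_trans (pn _))// (le_trans (normc_le_ell2_norm _ _))//.
  - by rewrite ger0_norm.
have ReD (y z : R[i]) : complex.Re (y + z) = complex.Re y + complex.Re z.
  by case: y z => [? ?] [].
have ImD (y z : R[i]) : complex.Im (y + z) = complex.Im y + complex.Im z.
  by case: y z => [? ?] [].
have ReB (y z : R[i]) : complex.Re (y - z) = complex.Re y - complex.Re z.
  by case: y z => [? ?] [].
have ImB (y z : R[i]) : complex.Im (y - z) = complex.Im y - complex.Im z.
  by case: y z => [? ?] [].
pose h x : R[i]^o := complex.Complex (lim (complex.Re (S n x) @[n --> \oo]))
                        (lim (complex.Im (S n x) @[n --> \oo])).
have tail N m : ell2_norm (S (N + m)%N - S N) <= C / (1 - q) * (q ^+ N - q ^+ (N + m)).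
  elim: m => [|m IH]; first by rewrite addn0 !subrr mulr0 ell2_norm0.
  rewrite addnS /S big_ord_recr/= addrAC (le_trans (ell2_normD _ _))//.
  apply: le_trans (lerD IH (FC _)) _.
  by rewrite exprS le_eqVlt; apply/orP; left; apply/eqP; field; rewrite gt_eqF.
(* Fatou is applied to S n - S N rather than to S n: N = 0 shows that h is in
   l^2, and the other N give the bounds on the remainders of h. *)
have limS N : exists2 v : ell2 R G, v = (fun x => h x - S N x) :> (G -> R[i]^o) &
    ell2_norm v <= C / (1 - q) * q ^+ N.
  apply: (@ell2_pointwise_limit (fun n => S n - S N)).
  - by rewrite mulr_ge0 ?exprn_ge0// divr_ge0// ltW.
  - exists N => //= n /= Nn; rewrite -(subnKC Nn) (le_trans (tail _ _))//.
    apply: ler_wpM2l; first by rewrite divr_ge0// ltW.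
    by rewrite gerBl exprn_ge0.
  - move=> x; have SB n : (S n - S N) x = S n x - S N x by [].
    apply: normc_cvg.
    + rewrite ReB; under eq_fun do rewrite SB ReB.
      apply: cvgB; last exact: cvg_cst.
      exact: (coord_cvg _ le_Re_normc).
    + rewrite ImB; under eq_fun do rewrite SB ImB.
      apply: cvgB; last exact: cvg_cst.
      exact: (coord_cvg _ le_Im_normc).
have [v vh _] := limS 0%N; exists v => N.
have [u uh uN] := limS N.
suff -> : v - \sum_(k < N) F k = u by [].
apply/val_inj/funext => x; rewrite /= uh.
have S0x : S 0%N x = 0 by rewrite /S big_ord0.
by rewrite [LHS](_ : _ = v x - S N x)// vh S0x subr0.
Qed.

End Ell2Norm.

(** * Bounded operators *)

Section BoundedOperators.
Set Implicit Arguments.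
Unset Strict Implicit.
Import Normc.
Variables (R : realType) (G : groupType).
Notation op := (ell2 R G -> ell2 R G).
Implicit Types (f : ell2 R G) (S T : op) (M K e : R).

(** An explicit bound is easier to propagate than [opnorm], which is a supremum
    and says nothing about unbounded operators. *)
Definition bounded_by T M : Prop :=
  linear T /\ forall f, ell2_norm (T f) <= M * ell2_norm f.

Lemma ell2_normZ_bound (a : R[i]) f M :
  ell2_norm f <= M -> ell2_norm (a *: f) <= normc a * M.
Proof.
move=> fM; apply: le_trans (ell2_normZ_le _ _) _.
by rewrite ler_wpM2l// normc_ge0.
Qed.

(** Linearity is a mere hypothesis on functions here, so the usual consequences
    are derived for an unbundled map. *)
Lemma linear_fun0 T : linear T -> T 0 = 0.
Proof.
move=> linT; have := linT 1 0 0; rewrite !scale1r addr0 => /eqP.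
by rewrite -subr_eq subrr eq_sym => /eqP.
Qed.

Lemma linear_funD T f g : linear T -> T (f + g) = T f + T g.
Proof. by move=> linT; have := linT 1 f g; rewrite !scale1r. Qed.

Lemma linear_funZ T (a : R[i]) f : linear T -> T (a *: f) = a *: T f.
Proof.
by move=> linT; have := linT a f 0; rewrite !addr0 linear_fun0// addr0.
Qed.

Lemma linear_funB T f g : linear T -> T (f - g) = T f - T g.
Proof.
by move=> linT; rewrite linear_funD// -scaleN1r linear_funZ// scaleN1r.
Qed.

Lemma linear_fun_sum T I (s : seq I) (F : I -> ell2 R G) :
  linear T -> T (\sum_(i <- s) F i) = \sum_(i <- s) T (F i).
Proof.
by move=> linT; apply: big_morph => [f g|]; rewrite ?linear_funD ?linear_fun0.
Qed.

Lemma linear_opD S T : linear S -> linear T -> linear (S + T).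
Proof.
move=> linS linT a f g; rewrite !fctE linS linT scalerDr.
by rewrite addrACA.
Qed.

Lemma linear_opZ (a : R[i]) T : linear T -> linear (a *: T).
Proof.
by move=> linT b f g; rewrite !fctE linT scalerDr !scalerA mulrC.
Qed.

Lemma linear_opB S T : linear S -> linear T -> linear (S - T).
Proof.
by move=> linS linT; rewrite -scaleN1r; apply: linear_opD => //; exact: linear_opZ.
Qed.

Lemma linear_comp S T : linear S -> linear T -> linear (S \o T).
Proof. by move=> linS linT a f g /=; rewrite linT linS. Qed.

Lemma bounded_by_weaken T M M' : M <= M' -> bounded_by T M -> bounded_by T M'.
Proof.
move=> MM' [linT TM]; split=> // f; rewrite (le_trans (TM f))//.
by rewrite ler_wpM2r// ell2_norm_ge0.
Qed.

Lemma bounded_by0 M : 0 <= M -> bounded_by 0 M.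
Proof.
move=> M0; split=> [b f g|f]; first by rewrite /= scaler0 addr0.
by rewrite [X in ell2_norm X](_ : _ = 0)// ell2_norm0 mulr_ge0// ell2_norm_ge0.
Qed.

Lemma bounded_byD S T M K :
  bounded_by S M -> bounded_by T K -> bounded_by (S + T) (M + K).
Proof.
move=> [linS SM] [linT TK]; split; first exact: linear_opD.
by move=> f; rewrite mulrDl fctE (le_trans (ell2_normD _ _))// lerD.
Qed.

Lemma bounded_byZ (a : R[i]) T M :
  bounded_by T M -> bounded_by (a *: T) (normc a * M).
Proof.
move=> [linT TM]; split; first exact: linear_opZ.
move=> f; rewrite fctE (le_trans (ell2_normZ_le _ _))// -mulrA.
by rewrite ler_wpM2l// normc_ge0.
Qed.

Lemma bounded_by_comp S T M K : 0 <= M ->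
  bounded_by S M -> bounded_by T K -> bounded_by (S \o T) (M * K).
Proof.
move=> M0 [linS SM] [linT TK]; split; first exact: linear_comp.
by move=> f /=; rewrite (le_trans (SM _))// -mulrA ler_wpM2l.
Qed.

Lemma bounded_by_lambda (g : G) : bounded_by (lambda R g) 1.
Proof.
split=> [a f h|f]; first exact: val_inj.
by rewrite ell2_norm_lambda mul1r.
Qed.

Lemma bounded_operatorP T :
  bounded_operator T <-> exists2 M, 0 <= M & bounded_by T M.
Proof.
split=> [[linT [M TM]]|[M _ [linT TM]]]; last by split=> //; exists M.
exists `|M|; first exact: normr_ge0.
by apply: bounded_by_weaken (ler_norm M) _.
Qed.

Lemma opnorm_le T M : 0 <= M -> bounded_by T M -> opnorm T <= M.
Proof.
move=> M0 [_ TM]; apply: ge_sup.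
  by exists (ell2_norm (T 0)); exists 0 => //=; rewrite ell2_norm0.
move=> _ [f /= f1 <-]; rewrite (le_trans (TM f))//.
by rewrite -[leRHS]mulr1 ler_wpM2l.
Qed.

Lemma opnorm_ge T f : bounded_operator T -> ell2_norm f <= 1 ->
  ell2_norm (T f) <= opnorm T.
Proof.
move=> /bounded_operatorP[M M0 [_ TM]] f1; apply: ub_le_sup; last by exists f.
exists M => _ [h /= h1 <-]; rewrite (le_trans (TM h))//.
by rewrite -[leRHS]mulr1 ler_wpM2l.
Qed.

Lemma opnorm_ge0 T : bounded_operator T -> 0 <= opnorm T.
Proof.
move=> bT; apply: le_trans (ell2_norm_ge0 (T 0)) _.
by apply: opnorm_ge; rewrite // ell2_norm0.
Qed.

Lemma bounded_by_opnorm T : bounded_operator T -> bounded_by T (opnorm T).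
Proof.
move=> bT; have [linT _] := bT; split=> // f.
have [f0|fn0] := eqVneq (ell2_norm f) 0.
  by rewrite (ell2_norm_eq0 f0) linear_fun0// ell2_norm0 mulr0.
have fp : 0 < ell2_norm f by rewrite lt_neqAle eq_sym fn0 ell2_norm_ge0.
have normcR (x : R) : 0 <= x -> normc (x%:C)%C = x.
  by move=> x0; rewrite /normc/= expr0n addr0 sqrtr_sqr ger0_norm.
pose c : R[i] := (ell2_norm f)%:C%C.
have c0 : c != 0.
  by apply: contra_neq fn0 => /(congr1 (@normc R)); rewrite normc0 normcR// ltW.
have nu : ell2_norm (c^-1 *: f) <= 1.
  by rewrite (le_trans (ell2_normZ_le _ _))// normcV normcR ?mulVf// ltW.
rewrite -{1}[f](scalerKV c0) linear_funZ//.
rewrite (le_trans (ell2_normZ_le _ _))// normcR ?(ltW fp)// mulrC.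
by rewrite ler_wpM2r// ?(ltW fp)// opnorm_ge.
Qed.

End BoundedOperators.

(** * The reduced C*-algebra *)

Section ReducedCstar.
Set Implicit Arguments.
Unset Strict Implicit.
Import Normc.
Variables (R : realType) (G : groupType).
Notation op := (ell2 R G -> ell2 R G).
Notation Cstar := (reduced_Cstar R G).
Implicit Types (f : ell2 R G) (S T : op) (M K e : R).

Lemma lambda_comp (g h : G) : lambda R g \o lambda R h = lambda R (g * h)%g.
Proof.
by apply/funext => f; apply/val_inj/funext => x /=; rewrite invgM mulgA.
Qed.

Lemma lambda1 : lambda R (1%g : G) = id.
Proof. by apply/funext => f; apply/val_inj/funext => x /=; rewrite invg1 mul1g. Qed.

Lemma span_lambda_gen (a : R[i]) (g : G) : span_lambda (a *: lambda R g).
Proof. by exists [fset g]%fset, (fun=> a); rewrite big_seq_fset1. Qed.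

Lemma span_lambda0 : span_lambda (0 : op).
Proof. by exists fset0, (fun=> 0); rewrite big_seq_fset0. Qed.

(** Two finite supports are first widened to their union by zero coefficients. *)
Lemma span_lambdaD S T : span_lambda S -> span_lambda T -> span_lambda (S + T).
Proof.
have widen (A B : {fset G}) (a : G -> R[i]) : (A `<=` B)%fset ->
    \sum_(g <- A) a g *: lambda R g =
    \sum_(g <- B) (if g \in A then a g else 0) *: lambda R g :> op.
  move=> AB; rewrite -(big_fset_incl _ AB) => [|x _ /negPf->]; last by rewrite scale0r.
  by apply: eq_big_seq => g ->.
move=> [A [a ->]] [B [b ->]].
exists (A `|` B)%fset, (fun g => (if g \in A then a g else 0) +
                                 (if g \in B then b g else 0)).
rewrite (widen _ _ a (fsubsetUl A B)) (widen _ _ b (fsubsetUr A B)) -big_split/=.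
by apply: eq_bigr => g _; rewrite scalerDl.
Qed.

Lemma span_lambda_sum I (s : seq I) (F : I -> op) :
  (forall i, span_lambda (F i)) -> span_lambda (\sum_(i <- s) F i).
Proof.
move=> sF; elim/big_ind: _ => //; [exact: span_lambda0|exact: span_lambdaD].
Qed.

Lemma span_lambda_comp S T :
  span_lambda S -> span_lambda T -> span_lambda (S \o T).
Proof.
move=> [A [a ->]] [B [b ->]].
have -> : (\sum_(g <- A) a g *: lambda R g) \o (\sum_(h <- B) b h *: lambda R h)
    = \sum_(g <- A) \sum_(h <- B) (a g * b h) *: lambda R (g * h)%g :> op.
  apply/funext => f /=; rewrite !fct_sumE; apply: eq_bigr => g _.
  rewrite !fctE fct_sumE.
  have [ling _] := bounded_by_lambda R g.
  rewrite linear_fun_sum// scaler_sumr; apply: eq_bigr => h _.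
  by rewrite !fctE linear_funZ// scalerA -lambda_comp.
by do 2![apply: span_lambda_sum => ?]; exact: span_lambda_gen.
Qed.

Lemma span_lambda_bounded S : span_lambda S -> exists2 M, 0 <= M & bounded_by S M.
Proof.
move=> [A [a ->]]; elim/big_ind: _ => [|S' T' [M M0 SM] [K K0 TK]|g _].
- by exists 0 => //; exact: bounded_by0.
- by exists (M + K); [exact: addr_ge0|exact: bounded_byD].
- exists (normc (a g) * 1); last exact/bounded_byZ/bounded_by_lambda.
  by rewrite mulr1 normc_ge0.
Qed.

(** Boundedness follows from one approximation by an element of the span, and
    strict bounds on [opnorm] can be traded for explicit non-strict ones because
    e is arbitrary. *)
Lemma reduced_CstarP T : Cstar T <->
  linear T /\ forall e, 0 < e -> exists2 S, span_lambda S & bounded_by (T - S) e.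
Proof.
split=> [[bT clT]|[linT clT]].
  split=> [|e e0]; first by case: bT.
  have [S sS TSe] := clT e e0; exists S => //.
  apply: bounded_by_weaken (ltW TSe) _; apply: bounded_by_opnorm.
  have /bounded_operatorP[M M0 TM] := bT.
  have [K K0 SK] := span_lambda_bounded sS.
  apply/bounded_operatorP; exists (M + normc (-1 : R[i]) * K).
    by rewrite addr_ge0// mulr_ge0// normc_ge0.
  by rewrite -scaleN1r; apply: bounded_byD => //; exact: bounded_byZ.
split.
  have [S sS TS] := clT 1 ltr01.
  have [K K0 SK] := span_lambda_bounded sS.
  apply/bounded_operatorP; exists (1 + K); first by rewrite addr_ge0.
  by rewrite -(subrK S T); exact: bounded_byD.
move=> e e0; have e20 : 0 < e / 2 by rewrite divr_gt0.
have [S sS TS] := clT _ e20; exists S => //.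
rewrite (le_lt_trans (opnorm_le (ltW e20) TS))//.
by rewrite ltr_pdivrMr// ltr_pMr// ltr1n.
Qed.

Lemma reduced_Cstar_bounded T : Cstar T -> exists2 M, 0 <= M & bounded_by T M.
Proof. by move=> [/bounded_operatorP]. Qed.

Lemma span_lambda_sub S : span_lambda S -> Cstar S.
Proof.
move=> sS; have [M M0 SM] := span_lambda_bounded sS.
apply/reduced_CstarP; split=> [|e e0]; first by case: SM.
by exists S => //; rewrite subrr; exact/bounded_by0/ltW.
Qed.

Lemma reduced_Cstar_closed T : linear T ->
  (forall e, 0 < e -> exists2 S, Cstar S & bounded_by (T - S) e) -> Cstar T.
Proof.
move=> linT clT; apply/reduced_CstarP; split=> // e e0.
have e20 : 0 < e / 2 by rewrite divr_gt0.
have [S /reduced_CstarP[_ clS] TS] := clT _ e20.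
have [S' sS' SS'] := clS _ e20; exists S' => //.
rewrite (splitr e) -(subrKA S T (- S')).
exact: bounded_byD.
Qed.

Lemma reduced_CstarD S T : Cstar S -> Cstar T -> Cstar (S + T).
Proof.
move=> /reduced_CstarP[linS clS] /reduced_CstarP[linT clT].
apply/reduced_CstarP; split=> [|e e0]; first exact: linear_opD.
have e20 : 0 < e / 2 by rewrite divr_gt0.
have [S' sS' SS'] := clS _ e20; have [T' sT' TT'] := clT _ e20.
exists (S' + T'); first exact: span_lambdaD.
by rewrite opprD addrACA (splitr e); exact: bounded_byD.
Qed.

Lemma reduced_Cstar_sum I (s : seq I) (F : I -> op) :
  (forall i, Cstar (F i)) -> Cstar (\sum_(i <- s) F i).
Proof.
move=> CF; elim/big_ind: _ => [||i _]; last exact: CF.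
  exact: (span_lambda_sub span_lambda0).
exact: reduced_CstarD.
Qed.

Lemma reduced_Cstar_comp S T : Cstar S -> Cstar T -> Cstar (S \o T).
Proof.
move=> CS; have [M M0 SM] := reduced_Cstar_bounded CS.
have /reduced_CstarP[linS clS] := CS.
move=> /reduced_CstarP[linT clT].
apply/reduced_CstarP; split=> [|e e0]; first exact: linear_comp.
have e20 : 0 < e / 2 by rewrite divr_gt0.
(* S T - S' T' = S (T - T') + (S - S') T'; T' is chosen first because the
   precision required of S' depends on the bound K of T'.  The shifts by 1 avoid
   dividing by a zero bound. *)
have M1 : 0 < M + 1 by rewrite ltr_wpDl.
have [T' sT' TT'] := clT _ (divr_gt0 e20 M1).
have [K K0 TK] := span_lambda_bounded sT'.
have K1 : 0 < K + 1 by rewrite ltr_wpDl.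
have [S' sS' SS'] := clS _ (divr_gt0 e20 K1).
exists (S' \o T'); first exact: span_lambda_comp.
have -> : (S \o T) - (S' \o T') = (S \o (T - T')) + ((S - S') \o T').
  apply/funext => f /=; rewrite !fctE /= (linear_funB _ _ linS)//.
  by rewrite subrKA.
have small (x : R) : 0 <= x -> x * (e / 2 / (x + 1)) <= e / 2.
  move=> x0; rewrite mulrCA ger_pMr// ler_pdivrMr ?ltr_wpDl//.
  by rewrite mul1r lerDl.
rewrite (splitr e); apply: bounded_byD.
  apply: bounded_by_weaken (small M M0) _; exact: bounded_by_comp.
apply: bounded_by_weaken (small K K0) _; rewrite mulrC.
by apply: bounded_by_comp; rewrite // divr_ge0 // ltW.
Qed.

Lemma reduced_Cstar_lambda (g : G) : Cstar (lambda R g).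
Proof.
by apply: span_lambda_sub; rewrite -[lambda R g]scale1r; exact: span_lambda_gen.
Qed.

Lemma reduced_CstarZ (a : R[i]) T : Cstar T -> Cstar (a *: T).
Proof.
move=> CT; have -> : a *: T = (a *: lambda R 1%g) \o T by rewrite lambda1.
have Ca : Cstar (a *: lambda R 1%g) by apply/span_lambda_sub/span_lambda_gen.
exact: reduced_Cstar_comp Ca CT.
Qed.

Lemma reduced_Cstar_ideal : ideal_of Cstar Cstar.
Proof.
split.
- exact: subset_refl.
- exact: (span_lambda_sub (span_lambda0)).
- exact: reduced_CstarD.
- exact: reduced_CstarZ.
- by move=> S T CS CT; split; exact: reduced_Cstar_comp.
Qed.

(** S Z = 1 lies in the ideal, hence so does T = T 1 for every T. *)
Lemma ideal_with_left_invertible (J : set op) S Z :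
  ideal_of Cstar J -> Cstar S -> J Z -> S \o Z = id -> J = Cstar.
Proof.
move=> [JC J0 JD JZ Jcomp] CS JZ' SZ; apply/seteqP; split=> // T CT.
have [J1 _] := Jcomp S Z CS JZ'; rewrite SZ in J1.
by have [] := Jcomp T id CT J1.
Qed.

(** Lets an equality between limits be checked on partial sums. *)
Lemma geometric_bound_eq0 f M (q : R) : 0 <= q < 1 ->
  (forall N, ell2_norm f <= M * q ^+ N) -> f = 0.
Proof.
move=> /andP[q0 q1] fM; apply/ell2_norm_eq0/le_anti; rewrite ell2_norm_ge0 andbT.
have cv : (M * q ^+ N) @[N --> \oo] --> (0 : R).
  by apply: (cvg_geometric M (z := q)); rewrite ger0_norm.
by apply: (cvgr_to_ge cv); near=> N.
Unshelve. all: by end_near. Qed.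

(** The inverse is S = \sum_k E^k.  A left inverse suffices for ideals, and it
    comes from the telescoping identity P_N (1 - E) = 1 - E^N, where P_N is the
    N-th partial sum. *)
Lemma neumann_inverse (E : op) (q : R) : 0 <= q < 1 -> Cstar E -> bounded_by E q ->
  exists2 S, Cstar S & forall f, S (f - E f) = f.
Proof.
move=> q01 CE [linE Eq]; have /andP[q0 q1] := q01.
have q10 : 0 < 1 - q by rewrite subr_gt0.
have powE k f : ell2_norm (iter k E f) <= ell2_norm f * q ^+ k.
  elim: k => [|k IH]; first by rewrite mulr1.
  by rewrite iterS (le_trans (Eq _))// exprS mulrCA ler_wpM2l.
pose P N : op := \sum_(k < N) iter k E.
have PE N f : P N f = \sum_(k < N) iter k E f by rewrite /P fct_sumE.
have CP N : Cstar (P N).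
  apply: reduced_Cstar_sum => -[k _] /=; elim: k => [|k IH].
    by rewrite -[iter 0 E]lambda1; exact: reduced_Cstar_lambda.
  exact: (reduced_Cstar_comp CE IH).
have linP N : linear (P N) by have [[]] := CP N.
have /choice[S SP] f : exists v, forall N,
    ell2_norm (v - P N f) <= ell2_norm f / (1 - q) * q ^+ N.
  have [v vP] := ell2_geometric_series q01 (fun k => powE k f).
  by exists v => N; rewrite PE.
have linS : linear S.
  move=> a f g; apply/eqP; rewrite -subr_eq0; apply/eqP.
  pose h := a *: f + g.
  apply: (@geometric_bound_eq0 _ (ell2_norm h / (1 - q) +
      (normc (-a) * (ell2_norm f / (1 - q)) +
       normc (-1 : R[i]) * (ell2_norm g / (1 - q)))) _ q01) => N.
  have -> : S h - (a *: S f + S g) =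
      (S h - P N h) + ((- a) *: (S f - P N f) + (-1) *: (S g - P N g)).
    rewrite /h linP scaleNr scaleN1r scalerBr -opprD addrACA -opprD.
    by rewrite [- (_ - (a *: P N f + _))]opprB subrKA.
  rewrite mulrDl; apply: le_trans (ell2_normD _ _) _.
  apply: lerD; first exact: SP.
  rewrite mulrDl; apply: le_trans (ell2_normD _ _) _.
  by apply: lerD; rewrite -mulrA; exact: ell2_normZ_bound.
exists S.
  apply: reduced_Cstar_closed => // e e0.
  have cv : ((1 - q)^-1 * q ^+ N) @[N --> \oo] --> (0 : R).
    by apply: (cvg_geometric (1 - q)^-1 (z := q)); rewrite ger0_norm.
  have [N _ /(_ N (leqnn N)) /= Ne] := (cvgr_lt _ cv _ e0).
  exists (P N); first exact: CP.
  apply: bounded_by_weaken (ltW Ne) _.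
  split; first exact: linear_opB.
  by move=> f; rewrite [leRHS]mulrC mulrA; exact: SP.
move=> f; apply/eqP; rewrite -subr_eq0; apply/eqP.
apply: (@geometric_bound_eq0 _ (ell2_norm (f - E f) / (1 - q) +
   normc (-1 : R[i]) * ell2_norm f) _ q01) => N.
have -> : S (f - E f) - f = (S (f - E f) - P N (f - E f)) + (-1) *: iter N E f.
  have -> : P N (f - E f) = f - iter N E f.
    elim: N => [|N IH]; first by rewrite PE big_ord0 subrr.
    rewrite PE big_ord_recr/= -PE IH.
    have -> : iter N E (f - E f) = iter N E f - E (iter N E f).
      elim: {IH} N => //= N ->; exact: linear_funB.
    by rewrite addrA subrK.
  by rewrite scaleN1r -addrA -opprD subrK.
rewrite mulrDl; apply: le_trans (ell2_normD _ _) _.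
apply: lerD; first exact: SP.
by rewrite -mulrA; exact: ell2_normZ_bound.
Qed.

End ReducedCstar.

(** * Averaging over translates *)

Section AveragedElement.
Set Implicit Arguments.
Unset Strict Implicit.
Import Normc.
Variables (R : realType) (G : groupType) (H : {fset G}) (w : G).
Variables (r s : G) (n : nat) (c : 'I_n -> G) (beta : G -> R[i]).
Notation op := (ell2 R G -> ell2 R G).
Notation Cstar := (reduced_Cstar R G).
Hypotheses (wH : w \in H) (n0 : (0 < n)%N) (beta_w : beta w != 0).
Hypothesis c_comm : forall i, centralizer (s * w * r)%g (c i).

Let X : op := \sum_(g <- H) beta g *: lambda R g.
Let Y (g : G) : op := \sum_(i < n) lambda R (c i * s * g * r * (c i)^-1)%g.

(** The left translation by (s w r)^-1 and the scalar make the contribution of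
    w to this average exactly the identity. *)
Definition averaged : op :=
  \sum_(i < n) (((n%:R * beta w)^-1 *: lambda R ((s * w * r)^-1 * c i * s)%g)
               \o X \o lambda R (r * (c i)^-1)%g).

Lemma averaged_ideal (J : set op) : ideal_of Cstar J -> J X -> J averaged.
Proof.
move=> [_ J0 JD JZ Jcomp] JX; rewrite /averaged.
elim/big_ind: _ => [||i _]; [exact: J0|exact: JD|].
have Cl := span_lambda_sub (span_lambda_gen (n%:R * beta w)^-1 ((s * w * r)^-1 * c i * s)%g).
have [J1 _] := Jcomp _ _ Cl JX.
by have [_] := Jcomp _ _ (reduced_Cstar_lambda R (r * (c i)^-1)%g) J1.
Qed.

(** Only the term g = w collapses: c_i commutes with s w r, so all n conjugates
    c_i (s w r) c_i^-1 are equal to s w r, which the outer translation cancels. *)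
Lemma averagedE f : averaged f = f +
  \sum_(g <- (H `\ w)%fset)
     (beta g / (n%:R * beta w)) *: lambda R (s * w * r)^-1%g (Y g f).
Proof.
have linl g := (bounded_by_lambda R g).1.
pose k := (s * w * r)^-1%g.
have nR : n%:R != 0 :> R[i] by rewrite pnatr_eq0 -lt0n.
have -> : averaged f = \sum_(g <- H) (beta g / (n%:R * beta w)) *: lambda R k (Y g f).
  rewrite /averaged fct_sumE /=.
  have term i : (n%:R * beta w)^-1 *: lambda R (k * c i * s)%g
        (X (lambda R (r * (c i)^-1)%g f)) =
      \sum_(g <- H) (beta g / (n%:R * beta w)) *:
         lambda R k (lambda R (c i * s * g * r * (c i)^-1)%g f).
    rewrite /X fct_sumE linear_fun_sum// scaler_sumr; apply: eq_bigr => g _.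
    rewrite !fctE linear_funZ// scalerA [(_ * beta g)%R]mulrC; congr (_ *: _).
    rewrite -[LHS]/((lambda R _ \o (lambda R g \o lambda R _)) f) -[RHS]/((_ \o _) f).
    by rewrite !lambda_comp !mulgA.
  transitivity (\sum_(i < n) \sum_(g <- H) (beta g / (n%:R * beta w)) *:
         lambda R k (lambda R (c i * s * g * r * (c i)^-1)%g f)).
    by apply: eq_bigr => i _; exact: term.
  rewrite exchange_big; apply: eq_bigr => g _.
  by rewrite /Y fct_sumE linear_fun_sum// scaler_sumr.
rewrite (big_fsetD1 w wH)/=; congr (_ + _).
have -> : Y w f = n%:R *: lambda R (s * w * r)%g f.
  rewrite /Y fct_sumE (eq_bigr (fun=> lambda R (s * w * r)%g f)) => [|i _].
    by rewrite sumr_const card_ord scaler_nat.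
  have ci := c_comm i; congr (lambda R _ f).
  by rewrite -[RHS](mulgK (c i)) -(c_comm i) !mulgA.
rewrite linear_funZ// scalerA.
rewrite -[lambda R k _]/((lambda R k \o lambda R _) f) lambda_comp mulVg lambda1.
by rewrite invfM mulrCA mulfV// mulr1 mulVf// scale1r.
Qed.

(** The translation by (s w r)^-1 is an isometry, so it does not enter the bound. *)
Lemma averaged_near_id : bounded_by (id - averaged)
  (\sum_(g <- (H `\ w)%fset) normc (beta g / beta w) * (n%:R^-1 * opnorm (Y g))).
Proof.
have CY g : Cstar (Y g).
  by apply: reduced_Cstar_sum => i; exact: reduced_Cstar_lambda.
have normn : normc (n%:R : R[i]) = n%:R.
  have -> : (n%:R : R[i]) = (n%:R : R)%:C%C by rewrite rmorph_nat.
  by rewrite /normc/= expr0n addr0 sqrtr_sqr ger0_norm.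
have -> : id - averaged = - \sum_(g <- (H `\ w)%fset)
     (beta g / (n%:R * beta w)) *: (lambda R (s * w * r)^-1%g \o Y g).
  apply/funext => f; rewrite !fctE averagedE opprD addrA subrr add0r.
  by rewrite fct_sumE.
have normN1 : normc (-1 : R[i]) = 1 by rewrite (normcN (1 : R[i])) normc1.
rewrite -scaleN1r -[X in bounded_by _ X]mul1r -{1}normN1; apply: bounded_byZ.
elim/big_rec2: _ => [|g M T _ TM]; first exact: bounded_by0.
apply: bounded_byD => //.
have -> : normc (beta g / beta w) * (n%:R^-1 * opnorm (Y g)) =
    normc (beta g / (n%:R * beta w)) * (1 * opnorm (Y g)).
  by rewrite invfM mul1r !normcM !normcV normn; ring.
apply/bounded_byZ/bounded_by_comp => //; first exact: bounded_by_lambda.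
by apply: bounded_by_opnorm; case: (CY g).
Qed.

End AveragedElement.

Theorem theorem6 (R : realType) (G : groupType) (H : {fset G}) (w : G)
  (wH : w \in H)
  (hyp : exists (r s : nat -> G) (c : forall n : nat, 'I_n -> G),
    (forall n : nat, (0 < n)%N ->
       forall i : 'I_n, centralizer (s n * w * r n)%g (c n i)) /\
    (forall g : G, g \in (H `\ w)%fset ->
       (fun n : nat => n%:R^-1 *
          opnorm (\sum_(i < n)
            lambda R (c n i * s n * g * r n * (c n i)^-1)%g)) @ \oo --> (0 : R)))
  (beta : G -> R[i]) (beta_w : beta w != 0) :
  ideal_generated (reduced_Cstar R G) (\sum_(g <- H) beta g *: lambda R g)
    = reduced_Cstar R G.
Proof.
have [r [s [c [c_comm small]]]] := hyp.
set X := \sum_(g <- H) beta g *: lambda R g.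
have CX : reduced_Cstar R G X.
  by apply: reduced_Cstar_sum => g; exact: (span_lambda_sub (span_lambda_gen _ _)).
have CC := reduced_Cstar_ideal R G.
(* q n is the bound on the norm of 1 - Z given by averaged_near_id. *)
pose q n := \sum_(g <- (H `\ w)%fset) Normc.normc (beta g / beta w) * (n%:R^-1 *
  opnorm (\sum_(i < n) lambda R (c n i * s n * g * r n * (c n i)^-1)%g)).
have q_cvg : q n @[n --> \oo] --> (0 : R).
  rewrite [X in _ --> X](_ : 0 = \sum_(g <- (H `\ w)%fset)
    Normc.normc (beta g / beta w) * 0); last first.
    by rewrite big1// => g _; rewrite mulr0.
  rewrite /q; under eq_fun do rewrite big_seq.
  rewrite big_seq.
  apply: cvg_big => [|g gH]; first exact: add_continuous.
  by apply: cvgM; [exact: cvg_cst|exact: small].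
(* The value at n = 0 carries no information, hence the successor. *)
have [n [n0 q1]] : exists n, (0 < n)%N /\ q n < 1.
  have [N _ Nq] := cvgr_lt _ q_cvg _ (@ltr01 R).
  by exists N.+1; split=> //; apply: (Nq N.+1); exact: leqnSn.
have near1 := averaged_near_id wH n0 beta_w (c_comm n n0).
pose Z := averaged H w (r n) (s n) (c n) beta; rewrite -/Z in near1.
have idealZ J : ideal_of (reduced_Cstar R G) J -> J X -> J Z.
  exact: averaged_ideal.
have CZ := idealZ _ CC CX.
have CE : reduced_Cstar R G (id - Z).
  rewrite -scaleN1r; apply: reduced_CstarD; last exact: reduced_CstarZ.
  by rewrite -lambda1; exact: reduced_Cstar_lambda.
have q0 : 0 <= q n.
  apply: sumr_ge0 => g _; rewrite mulr_ge0 ?normc_ge0// mulr_ge0 ?invr_ge0//.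
  have [bY _] : reduced_Cstar R G (\sum_(i < n) lambda R (c n i * s n * g * r n * (c n i)^-1)%g).
    by apply: reduced_Cstar_sum => i; exact: reduced_Cstar_lambda.
  exact: opnorm_ge0.
have q01 : 0 <= q n < 1 by rewrite q0.
have [S CS SZ] := neumann_inverse q01 CE near1.
have SZid : S \o Z = id.
  by apply/funext => f /=; rewrite -[RHS]SZ !fctE subKr.
apply/seteqP; split=> [T JT|T CT J [idJ XJ]].
  by apply: JT; split; [exact: CC|move=> _ ->; exact: CX].
have JZ : J Z by apply: idealZ idJ (XJ _ erefl).
by rewrite (ideal_with_left_invertible idJ CS JZ SZid).
Qed.
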